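(* For every real $x>0$, $$\exp\left(-\frac{1}{2}\psi\left(x+\frac{1}{3}\right)\right)<\frac{\Gamma(x)}{\sqrt{2\pi}\,x^x e^{-x}}<\exp\left(-\frac{1}{2}\psi\left(x+\frac{1}{3}-\frac{1}{18x+3}\right)\right).$$
   Context: $\Gamma$ is the classical Euler gamma function and $\psi(x)=\Gamma'(x)/\Gamma(x)$ for $x>0$ is the digamma function. *)

(* Defs.v *)
From mathcomp Require Import all_boot all_order all_algebra.
From mathcomp Require Import all_classical all_reals all_analysis.
Import Order.TTheory GRing.Theory Num.Theory.
Import numFieldNormedType.Exports.

Set Implicit Arguments.
Unset Strict Implicit.
Unset Printing Implicit Defensive.

Local Open Scope classical_set_scope.
Local Open Scope ring_scope.

(* Total functions; they carry their usual meaning for x > 0, where the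
   integral converges and Gamma is positive and differentiable. *)
Definition Gamma (R : realType) (x : R) : R :=
  \int[@lebesgue_measure R]_(t in `]0, +oo[) (t `^ (x - 1) * expR (- t)).

Definition digamma (R : realType) (x : R) : R :=
  (@Gamma R)^`()%classic x / Gamma x.

(* Main.v *)
(** Write [F x] for the logarithm of the middle term.  The recurrence
    [digamma (x + 1) = digamma x + x^-1] makes [F x + digamma (x + 1/3) / 2]
    strictly decrease and [F x + digamma (x + 1/3 - 1/(18 x + 3)) / 2] strictly
    increase under [x |-> x + 1]: after telescoping, these are two Pade bounds
    for [ln (1 + x^-1)], the second one combined with the monotonicity of
    [digamma].  Along [x + n] both tend to [0] by Stirling's formula, so they are
    positive and negative respectively.

    The calculus of [ln Gamma] uses only its convexity and its recurrence
    (Bohr-Mollerup).  In Stirling's formula the two monotone sequences provide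
    the existence of the limit, convexity shows that it does not depend on [x],
    and the duplication formula at integers, with [Gamma (1/2) = sqrt pi],
    identifies it. *)
Require Import Defs.
From mathcomp Require Import all_boot all_order all_algebra.
From mathcomp Require Import all_classical all_reals all_analysis.
From mathcomp Require Import measurable_realfun ring lra.
Import Order.TTheory GRing.Theory Num.Theory.
Import numFieldNormedType.Exports.

Set Implicit Arguments.
Unset Strict Implicit.
Unset Printing Implicit Defensive.

Local Open Scope classical_set_scope.
Local Open Scope ring_scope.

(** * Gamma as an extended-real integral *)

Lemma cvgn_le_harmonic (R : realType) (K l : R) (u : R^nat) :
  (forall n, `|l - u n| <= K / n.+1%:R) -> u n @[n --> \oo] --> l.
Proof.
move=> uK; have Kh : (K / n.+1%:R) @[n --> \oo] --> 0.
  rewrite -[X in _ --> X](mulr0 K); apply: cvgMl_tmp; exact: cvg_harmonic.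
apply/cvgrPdist_le => e e0.
move/cvgrPdist_le : Kh => /(_ _ e0); apply: filterS => n.
rewrite sub0r normrN => Kne; apply: (le_trans (uK n)).
exact: (le_trans (ler_norm _)).
Qed.

(** Compact segments that avoid [0], where the integrand may be singular. *)
Definition itv_harmonic (R : realType) (n : nat) : set R := `[n.+1%:R^-1, n.+1%:R]%classic.

Lemma bigcup_itv_harmonic (R : realType) :
  \bigcup_n @itv_harmonic R n = `]0, +oo[%classic.
Proof.
apply/seteqP; split => [x [n _]|x]; rewrite /itv_harmonic/= !in_itv/= ?andbT.
  by move=> /andP[+ _]; apply: lt_le_trans; rewrite invr_gt0.
move=> x0; pose y := Num.max x x^-1.
have y0 : 0 <= y by rewrite le_max (ltW x0).
exists (Num.truncn y) => //=.
rewrite in_itv/=; have := truncnS_gt y.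
rewrite {1}/y gt_max => /andP[xn vn]; apply/andP; split; last exact: ltW.
by rewrite invf_ple ?posrE// ltW.
Qed.

Lemma nondecreasing_itv_harmonic (R : realType) :
  nondecreasing_seq (@itv_harmonic R).
Proof.
apply/nondecreasing_seqP => n; apply/subsetPset => x.
rewrite /itv_harmonic/= !in_itv/=.
move=> /andP[nx xn]; apply/andP; split.
  by apply: le_trans nx; rewrite lef_pV2 ?posrE// ler_nat.
by apply: (le_trans xn); rewrite ler_nat.
Qed.

Definition gamma_integrand (R : realType) (x t : R) : R := t `^ (x - 1) * expR (- t).

Definition eGamma (R : realType) (x : R) : \bar R :=
  (\int[@lebesgue_measure R]_(t in `]0%R, +oo[) (gamma_integrand x t)%:E)%E.

Lemma GammaE (R : realType) (x : R) : Gamma x = fine (eGamma x).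
Proof. by []. Qed.

Lemma eGammaE (R : realType) (x : R) : eGamma x =
  (\int[@lebesgue_measure R]_(t in `]0%R, +oo[) (gamma_integrand x t)%:E)%E.
Proof. by []. Qed.

Lemma gamma_integrand_ge0 (R : realType) (x t : R) : 0 <= gamma_integrand x t.
Proof. by rewrite mulr_ge0 ?powR_ge0 ?expR_ge0. Qed.

Lemma measurable_gamma_integrand (R : realType) (x : R) (D : set R) :
  measurable_fun D (gamma_integrand x).
Proof.
apply: measurable_funTS; apply: measurable_funM.
  exact: measurable_powR.
by apply: measurableT_comp => //; exact: measurableT_comp.
Qed.

Lemma eGamma_ge0 (R : realType) (x : R) : (0 <= eGamma x)%E.
Proof. by apply: integral_ge0 => t _; rewrite lee_fin gamma_integrand_ge0. Qed.

Lemma cvg_eGamma (R : realType) (x : R) :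
  (\int[@lebesgue_measure R]_(t in @itv_harmonic R n) (gamma_integrand x t)%:E)%E
    @[n --> \oo] --> eGamma x.
Proof.
rewrite /eGamma -bigcup_itv_harmonic.
apply: ge0_nondecreasing_set_cvg_integral => //.
- exact: nondecreasing_itv_harmonic.
- by move=> n; exact: measurable_itv.
- by move=> n; apply/measurable_EFinP; exact: measurable_gamma_integrand.
- by move=> n t _; rewrite lee_fin gamma_integrand_ge0.
Qed.

Lemma gt0_continuous_powR (R : realType) (p x : R) : 0 < x ->
  {for x, continuous (fun t : R => t `^ p)}.
Proof.
move=> x0; apply: differentiable_continuous.
by apply/derivable1_diffP; apply: ex_derive; exact: is_derive1_powR.
Qed.

(** Integration by parts with [- expR (- t)] as antiderivative. The identity is in the extended
    reals because finiteness of the integral is itself deduced from the resulting recurrence. *)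
Lemma gamma_parts (R : realType) (x a b : R) : 0 < x -> 0 < a -> a < b ->
  (\int[@lebesgue_measure R]_(t in `[a, b]) (gamma_integrand (x + 1) t)%:E =
   (a `^ x * expR (- a) - b `^ x * expR (- b))%:E +
   x%:E * \int[@lebesgue_measure R]_(t in `[a, b]) (gamma_integrand x t)%:E)%E.
Proof.
move=> x0 a0 ab.
have cE (A : set R) : {within A, continuous (fun t : R => expR (- t))}.
  apply: continuous_subspaceT => t.
  by apply: continuous_comp; [exact: cvgN|exact: continuous_expR].
have cP p : {within `[a, b], continuous (fun t : R => t `^ p)}.
  apply: continuous_in_subspaceT => t; rewrite inE/= in_itv/= => /andP[t0 _].
  exact: gt0_continuous_powR (lt_le_trans a0 t0).
have dE (t : R) : is_derive t 1 (fun t : R => - expR (- t)) (expR (- t)).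
  by apply: is_derive_eq; rewrite mulrN1 opprK.
have cE' (t : R) : {for t, continuous (fun t : R => - expR (- t))}.
  by apply: differentiable_continuous; apply/derivable1_diffP; apply: ex_derive.
have /= := @integration_by_parts R (fun t => t `^ x) (fun t => - expR (- t))
  (fun t => x * t `^ (x - 1)) (fun t => expR (- t)) a b ab.
rewrite /gamma_integrand addrK => ->.
- under eq_integral do rewrite mulrN EFinN -mulrA EFinM.
  rewrite integral_ge0N; last first.
    move=> t _; rewrite -EFinM lee_fin mulr_ge0 ?(ltW x0)//.
    exact: gamma_integrand_ge0.
  rewrite ge0_integralZl_EFin ?(ltW x0)//; first last.
  - by apply/measurable_EFinP; exact: measurable_gamma_integrand.
  - by move=> t _; rewrite lee_fin gamma_integrand_ge0.
  by rewrite oppeK; congr (_%:E + _)%E; ring.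
- apply: continuous_in_subspaceT => t; rewrite inE/= in_itv/= => /andP[t0 _].
  by apply: cvgMl_tmp; exact: gt0_continuous_powR (lt_le_trans a0 t0).
- split.
  + move=> t; rewrite in_itv/= => /andP[/(lt_trans a0) t0 _].
    by apply: ex_derive; exact: is_derive1_powR.
  + by apply: cvg_at_right_filter; exact: gt0_continuous_powR.
  + by apply: cvg_at_left_filter; exact: gt0_continuous_powR (lt_trans a0 ab).
- move=> t; rewrite in_itv/= => /andP[/(lt_trans a0) t0 _].
  by rewrite powR_derive1// in_itv/= t0.
- exact: cE.
- split.
  + by move=> t _; apply: ex_derive.
  + by apply: cvg_at_right_filter; exact: cE'.
  + by apply: cvg_at_left_filter; exact: cE'.
- by move=> t _; rewrite derive1E; apply: derive_val.
Qed.

Lemma ler_ln_subr1 (R : realType) (t : R) : 0 < t -> ln t <= t - 1.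
Proof. by move=> t0; have := @le_ln1Dx R (t - 1); rewrite [1 + _]addrC subrK; apply; lra. Qed.

Lemma powR_expRN_le (R : realType) (x : R) : 0 < x ->
  exists2 K : R, 0 <= K & forall t : R, 0 < t -> t `^ x * expR (- t) <= K / t.
Proof.
(* The tangent of [ln] at [2 * x] gives [x * ln t <= x * ln (2 * x) + t / 2]. Half of the
   exponential decay remains, and [expR (- (t / 2)) <= 2 / t]. *)
move=> x0; exists (2 * expR (x * ln (2 * x))) => [|t t0].
  by rewrite mulr_ge0 ?expR_ge0.
have x20 : 0 < 2 * x by lra.
rewrite /powR gt_eqF// -expRD.
have ht : ln t <= ln (2 * x) + (t / (2 * x) - 1).
  rewrite [in leLHS](_ : t = (2 * x) * (t / (2 * x))); last by field; lra.
  by rewrite lnM ?posrE ?divr_gt0// lerD2l ler_ln_subr1 ?divr_gt0.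
have hx : x * ln t <= x * ln (2 * x) + t / 2.
  apply: (le_trans (ler_wpM2l (ltW x0) ht)); rewrite mulrDr lerD2l.
  have -> : x * (t / (2 * x) - 1) = t / 2 - x by field; lra.
  by rewrite gerBl ltW.
apply: (@le_trans _ _ (expR (x * ln (2 * x)) * expR (- (t / 2)))).
  by rewrite -expRD ler_expR; lra.
rewrite [2 * expR _]mulrC -[leRHS]mulrA ler_pM2l ?expR_gt0//.
rewrite expRN -[2 / t]invf_div lef_pV2 ?posrE ?expR_gt0 ?divr_gt0//.
by apply: le_trans (expR_ge1Dx _); lra.
Qed.

Lemma eGammaS (R : realType) (x : R) : 0 < x ->
  eGamma (x + 1) = (x%:E * eGamma x)%E.
Proof.
move=> x0.
pose B n := (n.+1%:R^-1 : R) `^ x * expR (- n.+1%:R^-1) - n.+1%:R `^ x * expR (- n.+1%:R).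
have B0 : B n @[n --> \oo] --> 0.
  rewrite -[X in _ --> X](subrr 0); apply: cvgB.
    rewrite -[X in _ --> X](mul0r (expR (- 0))); apply: cvgM.
      have /cvg_at_rightP := powR_cvg0 x0; apply; split; last exact: cvg_harmonic.
      by move=> n; rewrite invr_gt0.
    by apply: continuous_cvg; [exact: continuous_expR|apply: cvgN; exact: cvg_harmonic].
  have [K K0 hK] := powR_expRN_le x0.
  apply: (@cvgn_le_harmonic R K) => n; rewrite sub0r normrN ger0_norm.
    exact: hK.
  by rewrite mulr_ge0 ?powR_ge0 ?expR_ge0.
suff cS : (\int[@lebesgue_measure R]_(t in @itv_harmonic R n) (gamma_integrand (x + 1) t)%:E)%E
    @[n --> \oo] --> (x%:E * eGamma x)%E.
  by rewrite -(cvg_lim _ (@cvg_eGamma R (x + 1)))//; apply: cvg_lim.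
rewrite -[X in _ --> X]add0e.
(* The segment of index [0] is the single point [1], which [gamma_parts] excludes by [a < b]; hence
   the shifted index. *)
have cB : (B n.+1)%:E @[n --> \oo] --> 0%:E.
  by apply: cvg_EFin; [exact: nearW|rewrite -cvg_shiftS in B0].
have cG : (x%:E * \int[@lebesgue_measure R]_(t in @itv_harmonic R n.+1)
    (gamma_integrand x t)%:E)%E @[n --> \oo] --> (x%:E * eGamma x)%E.
  apply: cvgeZl => //.
  by have := @cvg_eGamma R x; rewrite -cvg_shiftS.
have parts n : (\int[@lebesgue_measure R]_(t in @itv_harmonic R n.+1)
    (gamma_integrand (x + 1) t)%:E)%E
    = ((B n.+1)%:E + x%:E * \int[@lebesgue_measure R]_(t in @itv_harmonic R n.+1)
    (gamma_integrand x t)%:E)%E.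
  apply: gamma_parts; rewrite ?invr_gt0//.
  by apply: (@lt_trans _ _ 1); rewrite ?ltr1n// invf_lt1 ?ltr1n.
by rewrite -cvg_shiftS (funext parts); apply: cvgeD.
Qed.

Lemma eGamma1 (R : realType) : eGamma (1 : R) = 1%E.
Proof.
have cE (t : R) : {for t, continuous (fun t : R => - expR (- t))}.
  by apply: differentiable_continuous; apply/derivable1_diffP; apply: ex_derive.
rewrite /eGamma integral_itv_obnd_cbnd; last first.
  by apply/measurable_EFinP; exact: measurable_gamma_integrand.
under eq_integral do rewrite /gamma_integrand subrr powRr0 mul1r.
rewrite (@ge0_continuous_FTC2y R _ (fun t => - expR (- t)) 0 0).
- by rewrite oppr0 expR0 EFinN oppeK add0e.
- by move=> t _; exact: expR_ge0.
- apply: continuous_subspaceT => t.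
  by apply: continuous_comp; [exact: cvgN|exact: continuous_expR].
- by rewrite -[X in _ --> X]oppr0; apply: cvgN; exact: cvgr_expR.
- by move=> t _; apply: ex_derive.
- by apply: cvg_at_right_filter; exact: cE.
- by move=> t _; rewrite derive1E derive_val mulrN1 opprK.
Qed.

(** For [t <= 1] the integrand at [x] is dominated by the one at [1], for [t >= 1] by the one at
    [y]. This carries finiteness from integers to reals. *)
Lemma le_eGammaD (R : realType) (x y : R) : 1 <= x <= y ->
  (eGamma x <= eGamma 1%R + eGamma y)%E.
Proof.
move=> /andP[x1 xy]; rewrite /eGamma -ge0_integralD//; first last.
- by apply/measurable_EFinP; exact: measurable_gamma_integrand.
- by move=> t _; rewrite lee_fin gamma_integrand_ge0.
- by apply/measurable_EFinP; exact: measurable_gamma_integrand.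
- by move=> t _; rewrite lee_fin gamma_integrand_ge0.
apply: ge0_le_integral => //.
- by move=> t _; rewrite lee_fin gamma_integrand_ge0.
- by apply/measurable_EFinP; exact: measurable_gamma_integrand.
- by apply: emeasurable_funD;
    apply/measurable_EFinP; exact: measurable_gamma_integrand.
move=> t /=; rewrite in_itv/= andbT => t0.
rewrite -EFinD lee_fin /gamma_integrand subrr -mulrDl.
rewrite ler_wpM2r ?expR_ge0// powRr0.
have [t1|/ltW t1] := leP t 1.
  rewrite ler_wpDr ?powR_ge0// -[leRHS](powRr0 t).
  by apply: ger_powR; rewrite ?t0 ?subr_ge0.
by rewrite ler_wpDl// ler_powR// lerB.
Qed.

Lemma eGamma_nat (R : realType) (n : nat) : eGamma (n.+1%:R : R) \is a fin_num.
Proof.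
elim: n => [|n ih]; first by rewrite eGamma1.
by rewrite -natr1 eGammaS ?ltr0n// fin_numM.
Qed.

(** The integral at [x + 1] is dominated through an integer above [x + 1]; the recurrence then
    descends to [x]. *)
Lemma eGamma_fin_num (R : realType) (x : R) : 0 < x -> eGamma x \is a fin_num.
Proof.
move=> x0; have xS : eGamma (x + 1) \is a fin_num.
  rewrite ge0_fin_numE ?eGamma_ge0//.
  have := @le_eGammaD R (x + 1) (Num.truncn (x + 1)).+1%:R.
  rewrite lerDr (ltW x0) ltW ?truncnS_gt// => /(_ isT) /le_lt_trans; apply.
  by rewrite ltey_eq fin_numD eGamma1 eGamma_nat.
have : eGamma x = (x^-1%:E * eGamma (x + 1))%E.
  by rewrite eGammaS// muleA -EFinM mulVf ?gt_eqF// mul1e.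
by move=> ->; rewrite fin_numM.
Qed.

Lemma Gamma1 (R : realType) : Gamma (1 : R) = 1.
Proof. by rewrite GammaE eGamma1. Qed.

Lemma GammaS (R : realType) (x : R) : 0 < x -> Gamma (x + 1) = x * Gamma x.
Proof. by move=> x0; rewrite !GammaE eGammaS// fineM ?eGamma_fin_num. Qed.

Lemma EFin_Gamma (R : realType) (x : R) : 0 < x -> (Gamma x)%:E = eGamma x.
Proof. by move=> x0; rewrite GammaE fineK ?eGamma_fin_num. Qed.

Lemma Gamma_gt0 (R : realType) (x : R) : 0 < x -> 0 < Gamma x.
Proof.
move=> x0.
(* At [x + 1] the power of [t] is at least [1] on [[1, 2]], so [expR (- 2)] bounds the integrand
   from below there. *)
suff GS : 0 < Gamma (x + 1) by move: GS; rewrite GammaS// pmulr_rgt0.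
rewrite -lte_fin EFin_Gamma ?addr_gt0//.
apply: (@lt_le_trans _ _ (\int[@lebesgue_measure R]_(t in `[1%R, 2%R])
  (cst (expR (- 2))%:E) t)%E).
  rewrite integral_cst//= lebesgue_measure_itv/= lte_fin ltr1n/=.
  by rewrite -EFinB -EFinM lte_fin mulr_gt0 ?expR_gt0// subr_gt0 ltr1n.
apply: (@le_trans _ _ (\int[@lebesgue_measure R]_(t in `[1%R, 2%R])
  (gamma_integrand (x + 1) t)%:E)%E).
  apply: ge0_le_integral => //.
  - by move=> t _; rewrite lee_fin expR_ge0.
  - by apply/measurable_EFinP; exact: measurable_gamma_integrand.
  move=> t /=; rewrite in_itv/= => /andP[t1 t2].
  rewrite lee_fin /gamma_integrand addrK -[leLHS]mul1r ler_pM ?expR_ge0//.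
    by rewrite -[leLHS](powRr0 t) ler_powR// ltW.
  by rewrite ler_expR lerN2.
apply: ge0_subset_integral => //.
- by apply/measurable_EFinP; exact: measurable_gamma_integrand.
- by move=> t _; rewrite lee_fin gamma_integrand_ge0.
move=> t /=; rewrite !in_itv/= andbT => /andP[t1 _].
exact: lt_le_trans t1.
Qed.

(* Logarithmic convexity of Gamma *)
Opaque Gamma eGamma.

(** Average the tangent bounds at the barycentre [m]: the linear terms cancel. *)
Lemma expR_convex_comb (R : realType) (a b u v : R) : 0 <= a -> 0 <= b -> a + b = 1 ->
  expR (a * u + b * v) <= a * expR u + b * expR v.
Proof.
move=> a0 b0 ab; set m := a * u + b * v.
have tangent w : expR m * (1 + (w - m)) <= expR w.
  have -> : expR w = expR m * expR (w - m) by rewrite -expRD addrC subrK.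
  by rewrite ler_wpM2l ?expR_ge0// expR_ge1Dx.
have -> : expR m = a * (expR m * (1 + (u - m))) + b * (expR m * (1 + (v - m))).
  have b1 : b = 1 - a by lra.
  by rewrite /m b1; ring.
by rewrite lerD// ler_wpM2l.
Qed.

(** Holder's inequality in disguise: divide the integrands at [x] and [y] by their integrals, apply
    convexity of the exponential pointwise, and integrate. *)
Lemma ln_Gamma_convex (R : realType) (x y a b : R) : 0 < x -> 0 < y ->
  0 <= a -> 0 <= b -> a + b = 1 ->
  ln (Gamma (a * x + b * y)) <= a * ln (Gamma x) + b * ln (Gamma y).
Proof.
move=> x0 y0 a0 b0 ab.
have z0 : 0 < a * x + b * y.
  have [a_eq0|a_neq0] := eqVneq a 0.
    by move: ab; rewrite a_eq0 mul0r !add0r => ->; rewrite mul1r.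
  apply: ltr_pwDl; last by apply: mulr_ge0 => //; exact: ltW.
  by apply: mulr_gt0 => //; rewrite lt_def a_neq0.
move: (Gamma_gt0 x0) (EFin_Gamma x0); move: (Gamma x) => gx gx0 Ex.
move: (Gamma_gt0 y0) (EFin_Gamma y0); move: (Gamma y) => gy gy0 Ey.
move: (Gamma_gt0 z0) (EFin_Gamma z0); move: (Gamma _) => gz gz0 Ez.
have [p Ep] : exists p, expR p = gx by exists (ln gx); rewrite lnK.
have [q Eq] : exists q, expR q = gy by exists (ln gy); rewrite lnK.
rewrite -Ep -Eq !expRK -ler_expR lnK ?posrE//.
move: (expR_gt0 (a * p + b * q)); set c := expR _ => c0.
rewrite -lee_fin Ez eGammaE.
have ca0 : 0 <= c * a / gx by rewrite divr_ge0 ?mulr_ge0// ltW.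
have cb0 : 0 <= c * b / gy by rewrite divr_ge0 ?mulr_ge0// ltW.
have mG r : measurable_fun (`]0, +oo[%classic : set R) (fun t : R => (gamma_integrand r t)%:E).
  by apply/measurable_EFinP; exact: measurable_gamma_integrand.
have gG r (t : R) : (0 <= (gamma_integrand r t)%:E)%E.
  by rewrite lee_fin gamma_integrand_ge0.
(* Here [c] is the weighted geometric mean of [gx] and [gy]; with these weights the right side
   integrates to [c * (a + b) = c]. *)
apply: (@le_trans _ _ ((c * a / gx)%:E * eGamma x + (c * b / gy)%:E * eGamma y)%E).
  rewrite (eGammaE x) (eGammaE y) -!ge0_integralZl_EFin//; [|exact: mG..].
  rewrite -ge0_integralD//; first last.
  - by apply: measurable_funeM; exact: mG.
  - by move=> t _; rewrite mule_ge0.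
  - by apply: measurable_funeM; exact: mG.
  - by move=> t _; rewrite mule_ge0.
  apply: ge0_le_integral => //.
  - exact: mG.
  - by apply: emeasurable_funD; apply: measurable_funeM; exact: mG.
  move=> t /=; rewrite in_itv/= andbT => t0.
  rewrite -!EFinM -EFinD lee_fin /gamma_integrand !mulrA -mulrDl.
  rewrite ler_wpM2r ?expR_ge0// /powR !gt_eqF//; set s := ln t.
  rewrite -Ep -Eq.
  have -> : c * a / expR p * expR ((x - 1) * s) = c * (a * expR ((x - 1) * s - p)).
    by rewrite expRD expRN; ring.
  have -> : c * b / expR q * expR ((y - 1) * s) = c * (b * expR ((y - 1) * s - q)).
    by rewrite expRD expRN; ring.
  rewrite -mulrDr; apply: le_trans (ler_wpM2l (ltW c0) (expR_convex_comb _ _ a0 b0 ab)).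
  rewrite -expRD ler_expR le_eqVlt; apply/orP; left; apply/eqP.
  have b1 : b = 1 - a by lra.
  by rewrite b1; ring.
rewrite -Ex -Ey -!EFinM -EFinD lee_fin !divfK ?gt_eqF//.
by rewrite -mulrDr ab mulr1.
Qed.

(** * The value of Gamma at one half *)

Lemma cvg_integral_itvcy (R : realType) (f : R -> R) (u : R^nat) :
  measurable_fun setT f -> (forall t, 0 <= f t) ->
  nonincreasing_seq u -> (forall n, 0 < u n) -> u n @[n --> \oo] --> 0 ->
  (\int[@lebesgue_measure R]_(t in `[u n, +oo[) (f t)%:E)%E @[n --> \oo]
    --> (\int[@lebesgue_measure R]_(t in `]0%R, +oo[) (f t)%:E)%E.
Proof.
move=> mf f0 ndu u0 cu.
have -> : `]0, +oo[%classic = \bigcup_n `[u n, +oo[%classic.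
  apply/seteqP; split => [x|x [n _]]/=; rewrite !in_itv/= !andbT; last first.
    exact: lt_le_trans.
  move=> x0; move/cvgrPdist_le : cu => /(_ x x0) [n _ /(_ n (leqnn n))].
  rewrite sub0r normrN gtr0_norm// => unx.
  by exists n => //=; rewrite in_itv/= unx.
apply: ge0_nondecreasing_set_cvg_integral => //.
- move=> m n mn; apply/subsetPset => x /=; rewrite !in_itv/= !andbT.
  exact: le_trans (ndu _ _ mn).
- by move=> n; apply/measurable_EFinP; exact: measurable_funTS.
- by move=> n t _; rewrite lee_fin.
Qed.

Lemma gamma_half_itvcy (R : realType) (a : R) : 0 < a ->
  (\int[@lebesgue_measure R]_(t in `[a, +oo[) (gamma_integrand 2^-1 t)%:E =
   2%:E * \int[@lebesgue_measure R]_(t in `[(a `^ 2^-1)%R, +oo[) (gauss_fun t)%:E)%E.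
Proof.
move=> a0.
pose F (t : R) := t `^ 2^-1.
have dF (t : R) : 0 < t -> is_derive t 1 F (2^-1 * t `^ (2^-1 - 1)).
  by move=> t0; exact: is_derive1_powR.
have dFE (t : R) : 0 < t -> F^`()%classic t = 2^-1 * t `^ (2^-1 - 1).
  by move=> t0; rewrite derive1E; apply: derive_val; exact: dF.
have cdF (t : R) : 0 < t -> {for t, continuous F^`()%classic}.
  move=> t0; rewrite /prop_for /continuous_at dFE//.
  apply: (@cvg_trans _ ((2^-1 * s `^ (2^-1 - 1)) @[s --> t])).
    by apply: near_eq_cvg; near=> s; rewrite dFE//; near: s; exact: lt_nbhsr.
  exact: cvgMl_tmp (gt0_continuous_powR t0).
have Fy : F t @[t --> +oo] --> +oo.
  apply/cvgryPge => A; near=> t.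
  have At : A ^+ 2 <= t by near: t; apply: nbhs_pinfty_ge; exact: num_real.
  rewrite /F powR12_sqrt; last exact: le_trans (sqr_ge0 _) At.
  by apply: (le_trans (ler_norm A)); rewrite -sqrtr_sqr ler_wsqrtr.
rewrite (@increasing_ge0_integration_by_substitutiony R F gauss_fun a); first last.
- by move=> t _; exact: gauss_fun_ge0.
- by apply: continuous_subspaceT; exact: continuous_gauss_fun.
- exact: Fy.
- split; last by apply: cvg_at_right_filter; exact: gt0_continuous_powR a0.
  move=> t; rewrite in_itv/= andbT => /(lt_trans a0) t0.
  by apply: ex_derive; exact: dF.
(* The substitution rule asks for a limit of the derivative at infinity: it is half the inverse of
   [F], so it tends to [0]. *)
- have V0 : (F t)^-1 @[t --> +oo] --> 0.
    apply/gtr0_cvgV0 => //; near=> t.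
    by rewrite /F powR_gt0//; near: t; apply: nbhs_pinfty_gt; exact: num_real.
  apply/cvg_ex; exists (2^-1 * 0) => /=.
  apply: (@cvg_trans _ ((2^-1 * (F t)^-1) @[t --> +oo])); last exact: cvgMl_tmp.
  apply: near_eq_cvg; near=> t.
  have t0 : 0 < t by near: t; apply: nbhs_pinfty_gt; exact: num_real.
  rewrite dFE// /F -powRN; congr (_ * _ `^ _); lra.
- apply/cvg_ex; exists (F^`()%classic a).
  by apply: cvg_at_right_filter; exact: cdF.
- by move=> t; rewrite in_itv/= andbT => /(lt_trans a0); exact: cdF.
- move=> s t; rewrite !in_itv/= !andbT => sa ta st.
  by rewrite /F gt0_ltr_powR// nnegrE ?(ltW (lt_le_trans a0 _)).
have GF t : a <= t ->
    ((gauss_fun \o F) * F^`()%classic) t = 2^-1 * gamma_integrand 2^-1 t.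
  move=> /(lt_le_trans a0) t0.
  transitivity (gauss_fun (F t) * F^`()%classic t) => //.
  rewrite dFE// /gauss_fun /F /gamma_integrand.
  by rewrite -powR_mulrn ?powR_ge0// -powRrM mulVf// powRr1 ?ltW//; ring.
under [X in (_ = _ * X)%E]eq_integral => t.
  rewrite inE/= in_itv/= andbT => /GF ->; rewrite EFinM; over.
rewrite /= ge0_integralZl_EFin//; first last.
- by apply/measurable_EFinP; exact: measurable_gamma_integrand.
- by move=> t _; rewrite lee_fin gamma_integrand_ge0.
by rewrite muleA -EFinM divff// mul1e.
Unshelve. all: end_near.
Qed.

Lemma Gamma_half (R : realType) : Gamma (2^-1 : R) = Num.sqrt pi.
Proof.
have h0 : 0 < (2^-1 : R) by rewrite invr_gt0.
suff E : eGamma (2^-1 : R) = (Num.sqrt pi)%:E by rewrite GammaE E.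
have V0 (n : nat) : 0 < (n.+1%:R^-1 : R) by rewrite invr_gt0.
have Vd : nonincreasing_seq (fun n => n.+1%:R^-1 : R).
  by move=> m n mn; rewrite lef_pV2 ?posrE// ler_nat.
have cL := @cvg_integral_itvcy R (gamma_integrand 2^-1) (fun n => n.+1%:R^-1)
  (@measurable_gamma_integrand R 2^-1 setT) (gamma_integrand_ge0 2^-1) Vd V0 (@cvg_harmonic R).
have cR : (\int[@lebesgue_measure R]_(t in `[(n.+1%:R^-1 `^ 2^-1)%R, +oo[) (gauss_fun t)%:E)%E
    @[n --> \oo] --> (Num.sqrt pi / 2 : R)%:E.
  rewrite -integral0y_gauss -integral_itv_obnd_cbnd; last first.
    by apply/measurable_EFinP/measurable_funTS; exact: measurable_gauss_fun.
  apply: cvg_integral_itvcy.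
  - exact: measurable_gauss_fun.
  - exact: gauss_fun_ge0.
  - by move=> m n mn; apply: ge0_ler_powR => //; rewrite ?nnegrE ?(ltW (V0 _))// Vd.
  - by move=> n; rewrite powR_gt0.
  - have /cvg_at_rightP := powR_cvg0 h0; apply; split => //; exact: cvg_harmonic.
rewrite eGammaE -(cvg_lim _ cL)//; apply: cvg_lim => //.
under eq_fun do rewrite gamma_half_itvcy ?V0//.
have -> : Num.sqrt pi = 2 * (Num.sqrt pi / 2) :> R by field.
by rewrite EFinM; apply: cvgeZl.
Qed.

(** * Convex solutions of the logarithmic recurrence *)

(** The hypotheses of the Bohr-Mollerup theorem on [ln Gamma], up to an additive constant, which
    derivatives do not see. *)
Definition bohr_mollerup (R : realType) (f : R -> R) : Prop :=
  (forall x y a b : R, 0 < x -> 0 < y -> 0 <= a -> 0 <= b -> a + b = 1 ->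
    f (a * x + b * y) <= a * f x + b * f y) /\
  (forall x : R, 0 < x -> f (x + 1) = f x + ln x).

Lemma convex_slope (R : realType) (f : R -> R) (x y z : R) :
  bohr_mollerup f -> 0 < x -> x < y -> y < z ->
  (f y - f x) / (y - x) <= (f z - f y) / (z - y).
Proof.
move=> [cf _] x0 xy yz; have z0 : 0 < z by lra.
have zx : 0 < z - x by lra. have zy : 0 < z - y by lra. have yx : 0 < y - x by lra.
have := cf x z ((z - y) / (z - x)) ((y - x) / (z - x)) x0 z0.
have -> : (z - y) / (z - x) * x + (y - x) / (z - x) * z = y by field; lra.
move=> /(_ _ _ _) H.
have {H} : f y <= (z - y) / (z - x) * f x + (y - x) / (z - x) * f z.
  by apply: H; [rewrite divr_ge0 ?ltW|rewrite divr_ge0 ?ltW|field; lra].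
rewrite -(ler_pM2r zx).
move: (f x) (f y) (f z) => fx fy fz.
have -> : ((z - y) / (z - x) * fx + (y - x) / (z - x) * fz) * (z - x) =
   (z - y) * fx + (y - x) * fz by field; lra.
move=> H; rewrite ler_pdivrMr// mulrAC ler_pdivlMr//.
by nra.
Qed.

(** The slope is the supremum of the chord slopes to the left of [x]; every chord slope to the right
    bounds them from above. *)
Lemma convex_support (R : realType) (f : R -> R) (x : R) : bohr_mollerup f -> 0 < x ->
  exists c : R, forall y, 0 < y -> f x + c * (y - x) <= f y.
Proof.
move=> bf x0; pose A := [set (f x - f y) / (x - y) | y in `]0, x[%classic].
have A0 : A !=set0 by exists ((f x - f (x / 2)) / (x - x / 2)), (x / 2) => //=;
   rewrite in_itv/=; lra.
have Aub z : x < z -> ubound A ((f z - f x) / (z - x)).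
  move=> xz _ [y /= + <-]; rewrite in_itv/= => /andP[y0 yx].
  exact: (convex_slope bf).
have hA : has_sup A by split => //; exists ((f (x + 1) - f x) / (x + 1 - x)); apply: Aub; lra.
exists (sup A) => y y0; have [yx|xy|->] := ltgtP y x.
- have : (f x - f y) / (x - y) <= sup A.
    by apply: sup_upper_bound => //; exists y => //=; rewrite in_itv/= y0.
  rewrite ler_pdivrMr ?subr_gt0//.
  by move: (f x) (f y) (sup A) => fx fy c; clear; lra.
- have : sup A <= (f y - f x) / (y - x) by apply: ge_sup => //; exact: Aub.
  rewrite ler_pdivlMr ?subr_gt0//.
  by move: (f x) (f y) (sup A) => fx fy c; clear; lra.
- by rewrite subrr mulr0 addr0.
Qed.

Definition diff2 (R : realType) (f : R -> R) (x h : R) : R :=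
  f (x + h) + f (x - h) - 2 * f x.

(* [ln (x + h) + ln (x - h) - 2 ln x = ln (1 - (h / x)^2)]. *)
Lemma diff2S (R : realType) (f : R -> R) (x h : R) :
  bohr_mollerup f -> 0 < h -> h <= x / 2 ->
  diff2 f x h <= diff2 f (x + 1) h + 2 * (h / x) ^+ 2.
Proof.
move=> [_ fS] h0 hx; have x0 : 0 < x by lra.
rewrite /diff2.
have -> : x + 1 + h = (x + h) + 1 by lra.
have -> : x + 1 - h = (x - h) + 1 by lra.
rewrite !fS; [|lra..].
have h1 : h / x <= 2^-1 by rewrite ler_pdivrMr//; lra.
have h2 : 0 < h / x by rewrite divr_gt0.
have l1 : ln (x + h) = ln x + ln (1 + h / x).
  by rewrite -lnM ?posrE; [congr ln; field; lra|lra|lra].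
have l2 : ln (x - h) = ln x + ln (1 - h / x).
  by rewrite -lnM ?posrE; [congr ln; field; lra|lra|lra].
(* With [u = h / x], [ln (1 - u^2) >= 1 - (1 - u^2)^-1], and this is at least [- 2 u^2] because
   [u <= 1/2]. *)
have l3 : - (2 * (h / x) ^+ 2) <= ln (1 + h / x) + ln (1 - h / x).
  rewrite -lnM ?posrE; [|lra..].
  move: (h / x) h1 h2 => u u1 u0.
  have v0 : 0 < (1 + u) * (1 - u) by nra.
  rewrite -[X in ln X]invrK lnV ?posrE ?invr_gt0// lerN2.
  apply: le_trans (ler_ln_subr1 _) _; first by rewrite invr_gt0.
  rewrite lerBlDr -[X in X <= _]mul1r ler_pdivrMr//.
  have uu : u ^+ 2 <= 4^-1 by nra.
  have : 0 <= u ^+ 2 * (1 - 2 * u ^+ 2) by rewrite mulr_ge0 ?sqr_ge0//; lra.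
  clear; rewrite -subr_ge0 => h; rewrite -subr_ge0; apply: le_trans h _.
  by rewrite le_eqVlt; apply/orP; left; apply/eqP; ring.
rewrite l1 l2; move: l3; clear.
move: (ln _) (ln (1 - _)) (ln x) ((h / x) ^+ 2) => a b c d.
by move: (f _) (f (x - h)) (f x) => u v w; lra.
Qed.

Lemma diff2D (R : realType) (f : R -> R) (x h : R) (n : nat) :
  bohr_mollerup f -> 0 < h -> h <= x / 2 ->
  diff2 f x h <= diff2 f (x + n%:R) h + n%:R * (2 * (h / x) ^+ 2).
Proof.
move=> bf h0 hx; have x0 : 0 < x by lra.
elim: n => [|n ih]; first by rewrite addr0 mul0r addr0.
have n0 : 0 <= n%:R :> R by [].
rewrite -natr1 addrA; move: (n%:R) n0 ih => m m0 ih.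
have hm : h <= (x + m) / 2 by clear ih; lra.
have := diff2S bf h0 hm.
have hxn : (h / (x + m)) ^+ 2 <= (h / x) ^+ 2.
  apply: lerXn2r; rewrite ?nnegrE ?divr_ge0 ?addr_ge0 ?(ltW h0) ?(ltW x0)//.
  by rewrite ler_wpM2l ?(ltW h0)// lef_pV2 ?posrE ?ltr_pwDl// lerDl.
move: ih hxn; clear.
move: (diff2 f x h) (diff2 f (x + m) h) (diff2 f _ h) => u v w.
by move: ((h / x) ^+ 2) ((h / (x + m)) ^+ 2) => a b; lra.
Qed.

(** Convexity bounds [f (x + h)] and [f (x - h)] by the chords from [x] to [x + 1] and to [x - 1].
    By the recurrence these have slopes [ln x] and [ln (x - 1)], which differ by at most
    [(x - 1)^-1]. *)
Lemma diff2_le (R : realType) (f : R -> R) (x h : R) :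
  bohr_mollerup f -> 1 < x -> 0 < h -> h <= 1 ->
  diff2 f x h <= h / (x - 1).
Proof.
move=> [cf fS] x1 h0 h1; rewrite /diff2.
have up := cf x (x + 1) (1 - h) h.
have dn := cf x (x - 1) (1 - h) h.
have xS : f x = f (x - 1) + ln (x - 1).
  by rewrite -fS ?subrK// subr_gt0.
have {up} : f (x + h) <= f x + h * ln x.
  move: up; rewrite fS; last exact: lt_trans x1.
  have -> : (1 - h) * x + h * (x + 1) = x + h by ring.
  move=> up; apply: le_trans (up _ _ _ _ _) _; [clear up; lra..|].
  by clear; move: (f x) (ln x) => fx lx; lra.
have {dn} : f (x - h) <= f x - h * ln (x - 1).
  move: dn; have -> : (1 - h) * x + h * (x - 1) = x - h by ring.
  move=> dn; apply: le_trans (dn _ _ _ _ _) _; [clear dn xS; lra..|].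
  by rewrite xS; clear; move: (f _) (ln _) => fx lx; lra.
have : ln x - ln (x - 1) <= (x - 1)^-1.
  rewrite -ln_div ?posrE; [|lra..].
  have -> : x / (x - 1) = 1 + (x - 1)^-1 by field; lra.
  by apply: le_ln1Dx; rewrite (lt_trans (ltrN10 _))// invr_gt0; lra.
move=> /(ler_wpM2l (ltW h0)); clear.
by move: (f (x + h)) (f (x - h)) (f x) (ln x) (ln (x - 1)) (x - 1)^-1 => a b c d e g; lra.
Qed.

(* The second difference bounds the distance between a difference quotient and
   the slope of a support line.  Pushed to [x + n] by the recurrence, it is at
   most [h / (x + n - 1) + 2 n (h / x)^2], hence [o(h)]. *)
Lemma bohr_mollerup_is_derive (R : realType) (f : R -> R) (x c : R) :
  bohr_mollerup f -> 0 < x ->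
  (forall y, 0 < y -> f x + c * (y - x) <= f y) -> is_derive x 1 f c.
Proof.
move=> bf x0 supp.
(* The excesses of [f] over the support line at [x + k] and [x - k] are both nonnegative and add up
   to the second difference, so each is bounded by it. *)
have sup2 (k : R) : k != 0 -> `|k| < x ->
    `|c - k^-1 * (f (k + x) - f x)| <= diff2 f x `|k| / `|k|.
  move=> k0 kx; have k1 : 0 < `|k| by rewrite normr_gt0.
  have : - x < k < x by rewrite -ltr_norml.
  move=> /andP[kl kr].
  have sp : f x + c * (k + x - x) <= f (k + x) by apply: supp; lra.
  have sm : f x + c * (x - k - x) <= f (x - k) by apply: supp; lra.
  have -> : diff2 f x `|k| = f (k + x) + f (x - k) - 2 * f x.
    rewrite /diff2; case: (ger0P k) => _; first by rewrite [x + k]addrC.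
    by rewrite opprK [x + k]addrC [f (x - k) + _]addrC.
  have -> : c - k^-1 * (f (k + x) - f x) = - ((f (k + x) - f x - c * k) / k) by field.
  rewrite normrN normf_div ler_pM2r ?invr_gt0//.
  move: sp sm; rewrite addrK (_ : x - k - x = - k); last by ring.
  move: (f (k + x)) (f (x - k)) (f x) => u v w; clear => sp sm.
  by rewrite ger0_norm; lra.
have lim : k^-1 *: (f (k *: 1 + x) - f x) @[k --> 0^'] --> c.
  apply/cvgrPdist_le => e e0.
  (* After [m.+2] steps [m] makes the term from [diff2_le] at most [e / 2 * h]; the last bound in
     [d] does the same for the accumulated quadratic error. The bounds [1] and [x / 2] are the
     hypotheses of [diff2_le] and [diff2D]. *)
  pose m := Num.truncn (2 / e).
  have me : 2 / e < m.+1%:R by exact: truncnS_gt.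
  pose d := Num.min (Num.min 1 (x / 2)) (e * x ^+ 2 / (4 * m.+2%:R)).
  have d0 : 0 < d.
    by rewrite /d !lt_min ltr01 !divr_gt0 ?mulr_gt0 ?exprn_gt0.
  near=> k.
  have k0 : k != 0 by near: k; exact: nbhs_dnbhs_neq.
  have kd : `|k| < d by near: k; apply: dnbhs0_lt.
  move: kd; rewrite /d !lt_min => /andP[/andP[kd1 kdx] kde].
  rewrite [k *: 1]mulr1; apply: (le_trans (sup2 k k0 _)).
    by apply: (lt_trans kdx); clear -x0; lra.
  have {k0} : 0 < `|k| by rewrite normr_gt0.
  move: (`|k| : R) kd1 kdx kde => h h1 hx he h0.
  rewrite ler_pdivrMr//.
  apply: (le_trans (@diff2D _ f x h m.+2 bf h0 (ltW hx))).
  have m1 : 1 <= m.+1%:R :> R by rewrite ler1n.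
  move: he; rewrite -(natr1 m.+1); move: (m.+1%:R : R) me m1 => M me m1 he.
  have e1 : diff2 f (x + (M + 1)) h <= e / 2 * h.
    apply: (le_trans (diff2_le bf _ h0 (ltW h1))); first by clear -x0 m1; lra.
    rewrite mulrC ler_pM2r// -[e / 2]invf_div lef_pV2 ?posrE ?divr_gt0//.
      by clear -x0 me; lra.
    by clear -x0 m1; lra.
  have e2 : (M + 1) * (2 * (h / x) ^+ 2) <= e / 2 * h.
    have M10 : 0 < M + 1 by clear -m1; lra.
    move: he; rewrite ltr_pdivlMr ?mulr_gt0// => he.
    have -> : (M + 1) * (2 * (h / x) ^+ 2) = (h * (4 * (M + 1)) / x ^+ 2) / 2 * h.
      by field; rewrite gt_eqF.
    rewrite ler_pM2r// ler_pM2r ?invr_gt0// ler_pdivrMr ?exprn_gt0//.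
    exact: ltW.
  apply: (le_trans (lerD e1 e2)).
  by rewrite -mulrDl -splitr.
split; first by apply/cvg_ex; exists c.
by apply: cvg_lim.
Unshelve. all: end_near.
Qed.

(** * The digamma function *)

Definition lnGamma (R : realType) (x : R) : R := ln (Gamma x).

Lemma bohr_mollerup_lnGamma (R : realType) : bohr_mollerup (@lnGamma R).
Proof.
split; first exact: ln_Gamma_convex.
move=> x x0; rewrite /lnGamma GammaS// lnM ?posrE ?Gamma_gt0//.
by rewrite addrC.
Qed.

Lemma expR_lnGamma (R : realType) (x : R) : 0 < x -> expR (lnGamma x) = Gamma x.
Proof. by move=> x0; rewrite /lnGamma lnK// posrE Gamma_gt0. Qed.

(** A support slope is the derivative of [lnGamma]; the chain rule for [Gamma = expR \o lnGamma]
    near [x] identifies it with the logarithmic derivative. *)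
Lemma digamma_support_is_derive (R : realType) (x : R) : 0 < x ->
  (forall y, 0 < y -> lnGamma x + digamma x * (y - x) <= lnGamma y) /\
  is_derive x 1 (@lnGamma R) (digamma x).
Proof.
move=> x0; have bm := bohr_mollerup_lnGamma R.
have [c supp] := convex_support bm x0.
have dc := bohr_mollerup_is_derive bm x0 supp.
suff -> : digamma x = c by split.
have dG : is_derive x 1 (expR \o @lnGamma R) (expR (lnGamma x) * c).
  exact: is_derive1_comp.
rewrite /digamma derive1E.
have GE : \forall y \near x, Gamma y = (expR \o @lnGamma R) y.
  by near=> y; rewrite /= expR_lnGamma//; near: y; exact: lt_nbhsr.
rewrite (near_eq_derive (1 : R^o) GE).
rewrite (@derive_val _ _ _ _ _ _ _ dG) expR_lnGamma//.
by rewrite mulrAC divff ?mul1r// gt_eqF// Gamma_gt0.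
Unshelve. all: end_near.
Qed.

Lemma digamma_support (R : realType) (x y : R) : 0 < x -> 0 < y ->
  lnGamma x + digamma x * (y - x) <= lnGamma y.
Proof. by move=> /digamma_support_is_derive[+ _]; exact. Qed.

Lemma digamma_is_derive (R : realType) (x : R) : 0 < x ->
  is_derive x 1 (@lnGamma R) (digamma x).
Proof. by move=> /digamma_support_is_derive[]. Qed.

Lemma lnGammaS (R : realType) (x : R) : 0 < x ->
  lnGamma (x + 1) = lnGamma x + ln x.
Proof. exact: (bohr_mollerup_lnGamma R).2. Qed.

Opaque lnGamma digamma.

Lemma digammaS (R : realType) (x : R) : 0 < x ->
  digamma (x + 1) = digamma x + x^-1.
Proof.
move=> x0.
have d1 : is_derive x 1 (@lnGamma R \o (fun y => y + 1)) (digamma (x + 1) * 1).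
  apply: is_derive1_comp; first exact: (digamma_is_derive (addr_gt0 x0 ltr01)).
  by apply: is_derive_eq; rewrite addr0.
have d2 : is_derive x 1 (@lnGamma R + @ln R) (digamma x + x^-1).
  by apply: is_deriveD; [exact: digamma_is_derive|exact: is_derive1_ln].
rewrite -[LHS]mulr1 -(@derive_val _ _ _ _ _ _ _ d1) -(@derive_val _ _ _ _ _ _ _ d2).
apply: near_eq_derive.
by near=> y; rewrite /= lnGammaS//; near: y; exact: lt_nbhsr.
Unshelve. all: end_near.
Qed.

(** Add the support inequalities at [x] and at [y]. *)
Lemma le_digamma (R : realType) (x y : R) : 0 < x -> x <= y -> digamma x <= digamma y.
Proof.
move=> x0; rewrite le_eqVlt => /predU1P[->//|xy]; have y0 := lt_trans x0 xy.
have yx0 : 0 < y - x by rewrite subr_gt0.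
rewrite -(ler_pM2r yx0).
have := digamma_support x0 y0; have := digamma_support y0 x0.
by move: (lnGamma x) (lnGamma y) (digamma x) (digamma y) => a b c d; clear; lra.
Qed.

(** The support line at [x] is evaluated at [x + 1], where [lnGamma] has grown by [ln x]. The lower
    bound that follows exchanges the two points. *)
Lemma digamma_le_ln (R : realType) (x : R) : 0 < x -> digamma x <= ln x.
Proof.
move=> x0; have := digamma_support x0 (addr_gt0 x0 ltr01).
by rewrite lnGammaS// addrAC subrr add0r mulr1 lerD2l.
Qed.

Lemma digamma_ge_ln (R : realType) (x : R) : 0 < x -> ln x - x^-1 <= digamma x.
Proof.
move=> x0; have := digamma_support (addr_gt0 x0 ltr01) x0.
rewrite lnGammaS// digammaS// opprD addrA subrr add0r mulrN1.
move: (lnGamma x) (ln x) (digamma x) => a b c; clear; lra.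
Qed.

(** * Rational bounds for the logarithm *)

Lemma derive_gt0_lt (R : realType) (f df : R -> R) (t : R) : 0 < t ->
  (forall s : R, 0 <= s -> is_derive s 1 f (df s)) ->
  (forall s, 0 < s -> 0 < df s) -> f 0 < f t.
Proof.
move=> t0 dF df0; apply: (@gtr0_derive1_incr R f 0 t) => //.
- by move=> s; rewrite in_itv/= => /andP[/ltW/dF ds _]; apply: ex_derive.
- move=> s; rewrite in_itv/= => /andP[s0 _].
  by rewrite derive1E (@derive_val _ _ _ _ _ _ _ (dF s (ltW s0))) df0.
- apply: continuous_in_subspaceT => s; rewrite inE/= in_itv/= => /andP[/dF ds _].
  by apply: differentiable_continuous; apply/derivable1_diffP; apply: ex_derive.
Qed.

(** At [t = x^-1], multiplying by [x + 1] turns the bound into [1 + (x + 1 / 3)^-1 / 2], the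
    quantity needed for [lower_gap]. The difference of the sides has a derivative of order [s^3] at
    [0]. *)
Lemma ln1D_gt_pade (R : realType) (t : R) : 0 < t ->
  t * (6 + 5 * t) / (2 * (3 + t) * (1 + t)) < ln (1 + t).
Proof.
move=> t0.
pose f (s : R) := ln (1 + s) - s * (6 + 5 * s) * ((2 * (3 + s) * (1 + s))^-1).
suff : f 0 < f t by rewrite /f !addr0 ln1 !mul0r subrr subr_gt0.
apply: (@derive_gt0_lt R f (fun s => s ^+ 3 / ((3 + s) ^+ 2 * (1 + s) ^+ 2)) t t0).
  move=> s s0; have s1 : 0 < 1 + s by lra.
  have s3 : 0 < 3 + s by lra.
  have d0 : 2 * (3 + s) * (1 + s) != 0 by rewrite gt_eqF// !mulr_gt0.
  have dl := is_derive1_ln s1.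
  rewrite /f; apply: is_derive_eq; rewrite /GRing.scale/=.
  by field; rewrite !gt_eqF.
move=> s s0; rewrite divr_gt0 ?exprn_gt0// mulr_gt0// exprn_gt0//; lra.
Qed.

(** The counterpart for [upper_gap]: at [t = x^-1] the bound times [x + 1] is
    [1 + (shifted_arg x)^-1 / 2]. *)
Lemma ln1D_lt_pade (R : realType) (t : R) : 0 < t ->
  ln (1 + t) < t * (12 + 12 * t + t ^+ 2) / (6 * (2 + t) * (1 + t)).
Proof.
move=> t0.
pose f (s : R) := s * (12 + 12 * s + s ^+ 2) * ((6 * (2 + s) * (1 + s))^-1) - ln (1 + s).
suff : f 0 < f t by rewrite /f !addr0 ln1 !mul0r subrr subr_gt0.
apply: (@derive_gt0_lt R f (fun s => s ^+ 4 / (6 * ((2 + s) ^+ 2 * (1 + s) ^+ 2))) t t0).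
  move=> s s0; have s1 : 0 < 1 + s by lra.
  have s2 : 0 < 2 + s by lra.
  have d0 : 6 * (2 + s) * (1 + s) != 0 by rewrite gt_eqF// !mulr_gt0.
  have dl := is_derive1_ln s1.
  rewrite /f; apply: is_derive_eq; rewrite /GRing.scale/=.
  by field; rewrite !gt_eqF.
move=> s s0; rewrite divr_gt0 ?exprn_gt0// mulr_gt0// mulr_gt0// exprn_gt0//; lra.
Qed.

(** * The two gaps *)

Definition lnRatio (R : realType) (x : R) : R :=
  lnGamma x - x * ln x + x - ln (2 * pi) / 2.

Lemma expR_lnRatio (R : realType) (x : R) : 0 < x ->
  expR (lnRatio x) = Gamma x / (Num.sqrt (2 * pi) * x `^ x * expR (- x)).
Proof.
move=> x0; have p0 : 0 < 2 * pi :> R by rewrite mulr_gt0 ?pi_gt0.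
have -> : Num.sqrt (2 * pi) = expR (ln (2 * pi) / 2) :> R.
  by rewrite -powR12_sqrt ?ltW// /powR gt_eqF// mulrC.
rewrite /powR gt_eqF// -expR_lnGamma// -!expRD -expRN -expRD; congr expR.
by rewrite /lnRatio; ring.
Qed.

Definition shifted_arg (R : realType) (x : R) : R := x + 1 / 3 - 1 / (18 * x + 3).

Lemma shifted_argE (R : realType) (x : R) : 0 < x ->
  shifted_arg x = 3 * x * (2 * x + 1) / (6 * x + 1).
Proof. by move=> x0; rewrite /shifted_arg; field; rewrite !gt_eqF//; lra. Qed.

Lemma le_shifted_arg (R : realType) (x : R) : 0 < x -> x <= shifted_arg x <= x + 1 / 3.
Proof.
move=> x0; apply/andP; split; last first.
  by rewrite /shifted_arg gerBl divr_ge0//; lra.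
rewrite /shifted_arg -addrA lerDl subr_ge0 !div1r lef_pV2 ?posrE; lra.
Qed.

(** The subtracted fraction shrinks as [x] grows. The argument thus advances by at least [1], and
    monotonicity of [digamma] replaces the exact recurrence. *)
Lemma shifted_argS (R : realType) (x : R) : 0 < x -> shifted_arg x + 1 <= shifted_arg (x + 1).
Proof.
move=> x0; rewrite /shifted_arg.
suff : 1 / (18 * (x + 1) + 3) <= 1 / (18 * x + 3).
  by move: (1 / (18 * x + 3)) (1 / (18 * (x + 1) + 3)) => a b; lra.
rewrite !div1r lef_pV2 ?posrE; lra.
Qed.

Lemma lnRatioS (R : realType) (x : R) : 0 < x ->
  lnRatio x - lnRatio (x + 1) = (x + 1) * ln (1 + x^-1) - 1.
Proof.
move=> x0; have v0 : 0 < x^-1 by rewrite invr_gt0.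
have -> : ln (1 + x^-1) = ln (x + 1) - ln x.
  by rewrite -ln_div ?posrE ?addr_gt0//; congr ln; field; rewrite gt_eqF.
by rewrite /lnRatio lnGammaS//; ring.
Qed.

(** The theorem says that this gap is positive and the next one negative. *)
Definition lower_gap (R : realType) (x : R) : R := lnRatio x + digamma (x + 1 / 3) / 2.
Definition upper_gap (R : realType) (x : R) : R := lnRatio x + digamma (shifted_arg x) / 2.

(** The decrease equals [(x + 1) * ln (1 + x^-1) - 1 - (x + 1 / 3)^-1 / 2], positive by
    [ln1D_gt_pade]. *)
Lemma lower_gapS (R : realType) (x : R) : 0 < x -> lower_gap (x + 1) < lower_gap x.
Proof.
move=> x0; have v0 : 0 < x^-1 by rewrite invr_gt0.
have x3 : 0 < x + 1 / 3 by lra.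
have x1 : 0 < x + 1 by lra.
have := ln1D_gt_pade v0; rewrite -(ltr_pM2l x1).
have -> : (x + 1) * (x^-1 * (6 + 5 * x^-1) / (2 * (3 + x^-1) * (1 + x^-1))) =
  1 + (x + 1 / 3)^-1 / 2.
  by field; rewrite !gt_eqF//; lra.
have := lnRatioS x0; rewrite /lower_gap [x + 1 + 1 / 3]addrAC digammaS//.
move: (ln (1 + _)) (lnRatio x) (lnRatio (x + 1)) (digamma (x + 1 / 3)) ((x + 1 / 3)^-1) => a b c d e.
clear; lra.
Qed.

Lemma upper_gapS (R : realType) (x : R) : 0 < x -> upper_gap x < upper_gap (x + 1).
Proof.
move=> x0; have v0 : 0 < x^-1 by rewrite invr_gt0.
have /andP[/(lt_le_trans x0) u0 _] := le_shifted_arg x0.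
have x1 : 0 < x + 1 by lra.
have u1 := addr_gt0 u0 ltr01.
have := le_digamma u1 (shifted_argS x0); rewrite digammaS//.
have H := ln1D_lt_pade v0; rewrite -(ltr_pM2l x1) in H; move: H.
have -> : (x + 1) * (x^-1 * (12 + 12 * x^-1 + x^-1 ^+ 2) / (6 * (2 + x^-1) * (1 + x^-1))) =
  1 + (shifted_arg x)^-1 / 2.
  by rewrite shifted_argE//; field; rewrite !gt_eqF//; lra.
have := lnRatioS x0; rewrite /upper_gap.
move: (ln (1 + _)) (lnRatio x) (lnRatio (x + 1)) (digamma (shifted_arg (x + 1)))
  (digamma (shifted_arg x)) ((shifted_arg x)^-1) => a b c d e g.
clear; lra.
Qed.

(** The logarithm of [Gamma x] divided by Stirling's approximation [sqrt (2 pi / x) (x / e)^x]; it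
    is either gap with [ln x] in place of the digamma value. *)
Definition stirling_err (R : realType) (x : R) : R := lnRatio x + ln x / 2.

Lemma digamma_near_ln (R : realType) (x y : R) : 0 < x -> x <= y <= x + 1 / 3 ->
  `|digamma y - ln x| <= x^-1.
Proof.
move=> x0 /andP[xy yx]; have y0 := lt_le_trans x0 xy.
have lo := le_trans (digamma_ge_ln x0) (le_digamma x0 xy).
have up : digamma y <= ln x + x^-1.
  apply: (le_trans (digamma_le_ln y0)).
  have -> : ln y = ln x + ln (1 + (y / x - 1)).
    by rewrite -lnM ?posrE; [congr ln; field; rewrite gt_eqF|..|rewrite addrC subrK divr_gt0].
  rewrite lerD2l; apply: le_trans (le_ln1Dx _) _; first by rewrite ltrBrDr addrC subrr divr_gt0.
  by rewrite lerBlDr ler_pdivrMr// mulrDl mulVf ?gt_eqF//; lra.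
by move: lo up; move: (digamma y) (ln x) (x^-1) => a b c; clear; rewrite ler_norml; lra.
Qed.

Lemma lower_gap_stirling (R : realType) (x : R) : 0 < x ->
  `|lower_gap x - stirling_err x| <= x^-1.
Proof.
move=> x0; have : `|digamma (x + 1 / 3) - ln x| <= x^-1.
  by apply: digamma_near_ln => //; lra.
rewrite /lower_gap /stirling_err !ler_norml.
by move: (digamma _) (ln x) (x^-1) (lnRatio x) => a b c d; clear; lra.
Qed.

Lemma upper_gap_stirling (R : realType) (x : R) : 0 < x ->
  `|upper_gap x - stirling_err x| <= x^-1.
Proof.
move=> x0; have := digamma_near_ln x0 (le_shifted_arg x0).
rewrite /upper_gap /stirling_err !ler_norml.
by move: (digamma _) (ln x) (x^-1) (lnRatio x) => a b c d; clear; lra.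
Qed.

(** * Stirling's formula *)

Lemma le_inv_addn (R : realType) (x : R) (n : nat) : 0 < x ->
  (x + n%:R)^-1 <= (1 + x^-1) / n.+1%:R.
Proof.
move=> x0; have n0 : 0 <= n%:R :> R by [].
rewrite -natr1; move: (n%:R) n0 => m m0.
rewrite ler_pdivlMr ?ltr_wpDl// mulrC ler_pdivrMr ?ltr_pwDl//.
have -> : (1 + x^-1) * (x + m) = m + 1 + x + m / x by field; rewrite gt_eqF.
have : 0 <= m / x by rewrite divr_ge0// ltW.
by move: (m / x) => a; lra.
Qed.

Lemma cvgn_le_inv_addn (R : realType) (x K : R) (u v : R^nat) (l : R) : 0 < x -> 0 <= K ->
  (forall n, `|u n - v n| <= K / (x + n%:R)) ->
  u n @[n --> \oo] --> l -> v n @[n --> \oo] --> l.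
Proof.
move=> x0 K0 uv ul.
have d0 : (u n - v n) @[n --> \oo] --> 0.
  apply: (@cvgn_le_harmonic R (K * (1 + x^-1))) => n.
  rewrite sub0r normrN; apply: (le_trans (uv n)).
  by rewrite -mulrA ler_wpM2l// le_inv_addn.
have -> : v = (fun n => u n - (u n - v n)) by apply/funext => n; rewrite opprB addrC subrK.
by rewrite -[l]subr0; apply: cvgB.
Qed.

Lemma nonincreasing_lower_gap (R : realType) (x : R) : 0 < x ->
  nonincreasing_seq (fun n => lower_gap (x + n%:R)).
Proof.
move=> x0; apply/nonincreasing_seqP => n.
by rewrite -natr1 addrA ltW// lower_gapS// ltr_pwDl.
Qed.

Lemma nondecreasing_upper_gap (R : realType) (x : R) : 0 < x ->
  nondecreasing_seq (fun n => upper_gap (x + n%:R)).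
Proof.
move=> x0; apply/nondecreasing_seqP => n.
by rewrite -natr1 addrA ltW// upper_gapS// ltr_pwDl.
Qed.

Lemma upper_gap_le_lower_gap (R : realType) (x : R) : 0 < x -> upper_gap x <= lower_gap x.
Proof.
move=> x0; have /andP[xu ux] := le_shifted_arg x0.
by rewrite lerD2l ler_pM2r ?invr_gt0// le_digamma// (lt_le_trans x0).
Qed.

(** The lower gaps decrease and stay above the upper gaps, which increase from [upper_gap x]. They
    therefore converge, and the error follows them within [(x + n)^-1]. *)
Lemma is_cvg_stirling_err (R : realType) (x : R) : 0 < x ->
  exists l : R, stirling_err (x + n%:R) @[n --> \oo] --> l.
Proof.
move=> x0; have : cvgn (fun n => lower_gap (x + n%:R)).
  apply: nonincreasing_is_cvgn; first exact: nonincreasing_lower_gap.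
  exists (upper_gap x) => _ [n _ <-].
  apply: le_trans (upper_gap_le_lower_gap _); last by rewrite ltr_pwDl.
  by have := @nondecreasing_upper_gap R x x0 0%N n (leq0n n); rewrite addr0.
move=> /cvg_ex[l cl]; exists l; apply: (@cvgn_le_inv_addn R x 1 _ _ l x0 ler01 _ cl) => n.
by rewrite div1r lower_gap_stirling// ltr_pwDl.
Qed.

(** By convexity [lnGamma] grows over [[x, x + s]] by an amount between [s * digamma x] and
    [s * digamma (x + s)]. The bound makes the limit independent of the starting point. *)
Lemma stirling_err_shift (R : realType) (x s : R) : 0 < x -> 0 <= s ->
  `|stirling_err (x + s) - stirling_err x| <= (s + s ^+ 2) / x.
Proof.
move=> x0 s0; have xs0 : 0 < x + s by rewrite ltr_pwDl.
have lo := digamma_support x0 xs0; have up := digamma_support xs0 x0.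
have dlo := digamma_ge_ln x0; have dup := digamma_le_ln xs0.
have E : ln (x + s) = ln x + ln (1 + s / x).
  by rewrite -lnM ?posrE; [congr ln; field; rewrite gt_eqF|..|rewrite ltr_wpDr// divr_ge0// ltW].
have sx0 : 0 <= s / x by rewrite divr_ge0// ltW.
have l0 : 0 <= ln (1 + s / x) by rewrite ln_ge0// lerDl.
have l1 : ln (1 + s / x) <= s / x by rewrite le_ln1Dx// (lt_le_trans (ltrN10 _)).
have l2 : s / (x + s) <= ln (1 + s / x).
  rewrite -[X in ln X]invrK lnV ?posrE ?invr_gt0 ?ltr_pwDl// -[leLHS]opprK lerN2.
  apply: le_trans (ler_ln_subr1 _) _; first by rewrite invr_gt0 ltr_pwDl.
  by rewrite le_eqVlt; apply/orP; left; apply/eqP; field; rewrite !gt_eqF.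
move: lo up dlo dup; rewrite /stirling_err /lnRatio E.
have -> : x + s - x = s by ring.
have -> : x - (x + s) = - s by ring.
move: l0 l1 l2 {E}; move: (ln (1 + s / x)) (ln x) (ln (2 * pi)) => l lx lp.
move: (lnGamma x) (lnGamma (x + s)) (digamma x) (digamma (x + s)) => g gs d ds.
move=> l0 l1 l2 lo up dlo dup.
have h1 : gs - g <= s * (lx + l) by have := ler_wpM2l s0 dup; lra.
have h2 : s * lx - s / x <= gs - g.
  by have := ler_wpM2l s0 dlo; rewrite mulrBr; lra.
(* The difference is [gs - g - s * lx - (x + s) * l + s + l / 2], where [l] lies between
   [s / (x + s)] and [s / x]. *)
rewrite ler_norml; apply/andP; split.
  have h3 := ler_wpM2l (ltW xs0) l1.
  have h4 : (x + s) * (s / x) = s + s ^+ 2 / x by field; rewrite gt_eqF.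
  have -> : - ((s + s ^+ 2) / x) = - (s / x) - s ^+ 2 / x by ring.
  move: h2 h3 h4 l0; move: (s / x) (s ^+ 2 / x) => a b; clear; nra.
have h3 := ler_wpM2l (ltW x0) l2.
have h4 : x * (s / (x + s)) = s - s ^+ 2 / (x + s) by field; rewrite gt_eqF.
have h5 : s ^+ 2 / (x + s) <= s ^+ 2 / x.
  by rewrite ler_wpM2l ?sqr_ge0// lef_pV2 ?posrE// lerDl.
have -> : (s + s ^+ 2) / x = s / x + s ^+ 2 / x by ring.
move: h1 h3 h4 h5 l1 sx0.
move: (s / x) (s ^+ 2 / x) (s / (x + s)) (s ^+ 2 / (x + s)) => a b c e; clear; nra.
Qed.

Lemma lnGammaE (R : realType) (x : R) : 0 < x -> lnGamma x = ln (Gamma x).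
Proof. by move=> x0; rewrite -[LHS]expRK expR_lnGamma. Qed.

(** Legendre's formula at positive integers. In the induction both sides gain
    [ln k + ln (k + 2^-1)]; the base case rests on [Gamma_half]. *)
Lemma lnGamma_duplication_nat (R : realType) (n : nat) : let m : R := n.+1%:R in
  lnGamma m + lnGamma (m + 2^-1) = (1 - 2 * m) * ln 2 + ln pi / 2 + lnGamma (2 * m).
Proof.
have h0 : 0 < 2^-1 :> R by rewrite invr_gt0.
have f1 : lnGamma (1 : R) = 0 by rewrite lnGammaE// Gamma1 ln1.
have f2 : lnGamma (2 : R) = 0.
  by rewrite mulr2n lnGammaS// f1 ln1 addr0.
have fh : lnGamma (2^-1 : R) = ln pi / 2.
  rewrite lnGammaE// Gamma_half -powR12_sqrt ?pi_ge0// ln_powR.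
  by rewrite mulrC.
elim: n => [|n ih] m.
  have -> : m = 1 by [].
  rewrite mulr1 f1 f2 [1 + 2^-1]addrC lnGammaS// fh lnV ?posrE//.
  by move: (ln 2) (ln pi) => a b; clear; lra.
rewrite /m -(natr1 n.+1); move: ih; rewrite /=; set k : R := n.+1%:R => ih.
have k0 : 0 < k by rewrite ltr0n.
have kh0 : 0 < k + 2^-1 by rewrite addr_gt0.
have k20 : 0 < 2 * k by rewrite mulr_gt0.
have -> : 2 * (k + 1) = 2 * k + 1 + 1 by ring.
rewrite [k + 1 + 2^-1]addrAC !lnGammaS ?addr_gt0//.
have -> : 2 * k + 1 = 2 * (k + 2^-1) by rewrite mulrDr divff.
rewrite !lnM ?posrE//; move: ih.
move: (ln 2) (ln k) (ln (k + _)) (lnGamma k) (lnGamma (k + _))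
  (lnGamma (2 * k)) (ln pi) => a b c d e g p.
clear; lra.
Qed.

(** The constant [ln (2 * pi) / 2] in [lnRatio] is what cancels here. A common limit [l] of the
    three errors equals [l + l - l], hence the limit of the right side. *)
Lemma stirling_err_duplication (R : realType) (n : nat) : let m : R := n.+1%:R in
  stirling_err m + stirling_err (m + 2^-1) - stirling_err (2 * m) =
  2^-1 - m * ln (1 + (2 * m)^-1).
Proof.
move=> m; have m0 : 0 < m by rewrite ltr0n.
have := lnGamma_duplication_nat R n; rewrite -/m.
have E : ln (m + 2^-1) = ln m + ln (1 + (2 * m)^-1).
  rewrite -lnM ?posrE ?addr_gt0 ?invr_gt0 ?mulr_gt0//.
  by congr ln; field; rewrite gt_eqF.
rewrite /stirling_err /lnRatio E !lnM ?posrE ?pi_gt0//.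
move: (ln 2) (ln m) (ln (1 + (2 * m)^-1)) (lnGamma m) (lnGamma (m + _))
  (lnGamma (2 * m)) (ln pi) => a b c d e g p.
by clear => H; have -> : d = (1 - 2 * m) * a + p / 2 + g - e; [rewrite -H addrK|field].
Qed.

Lemma cvg_stirling_err1 (R : realType) : stirling_err (1 + n%:R : R) @[n --> \oo] --> 0.
Proof.
have [l cl] := is_cvg_stirling_err (@ltr01 R).
suff l0 : l = 0 by rewrite -[X in _ --> X]l0.
have ch : stirling_err (1 + n%:R + 2^-1 : R) @[n --> \oo] --> l.
  apply: (@cvgn_le_inv_addn R 1 (2^-1 + 2^-1 ^+ 2) _ _ l ltr01 _ _ cl) => [|n]; first lra.
  by rewrite distrC stirling_err_shift// ?ltr_pwDl// invr_ge0.
have c2 : stirling_err (2 * (1 + n%:R) : R) @[n --> \oo] --> l.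
  (* Since [2 (1 + n) = 1 + (2 n + 1)], this is a subsequence of the original one. *)
  have -> : (fun n => stirling_err (2 * (1 + n%:R) : R)) =
      (fun n => stirling_err (1 + n%:R)) \o (fun n => n.*2.+1).
    apply/funext => n /=; congr stirling_err.
    by rewrite -(natr1 n.*2) -mul2n natrM; ring.
  apply: cvg_comp cl; apply/cvgnyPge => A; near=> n.
  have : (A <= n)%N by near: n; exact: nbhs_infty_ge.
  by move=> /leq_trans; apply; rewrite -addnn -addnS leq_addr.
have cD : (2^-1 - (1 + n%:R) * ln (1 + (2 * (1 + n%:R))^-1) : R) @[n --> \oo] --> l.
  have -> : (fun n => 2^-1 - (1 + n%:R) * ln (1 + (2 * (1 + n%:R))^-1) : R) =
    (fun n => stirling_err (1 + n%:R) + stirling_err (1 + n%:R + 2^-1)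
      - stirling_err (2 * (1 + n%:R))).
    by apply/funext => n; have := stirling_err_duplication R n; rewrite -(nat1r n) => ->.
  by rewrite -[l](addrK l); apply: cvgB => //; apply: cvgD.
(* With [m = 1 + n], the product [m * ln (1 + (2 * m)^-1)] lies between [m / (2 * m + 1)] and
   [1 / 2]. *)
have c0 : (2^-1 - (1 + n%:R) * ln (1 + (2 * (1 + n%:R))^-1) : R) @[n --> \oo] --> 0.
  apply: (@cvgn_le_inv_addn R 1 1 (fun=> 0) _ 0 ltr01 ler01 _ (cvg_cst _)) => n.
  have : 0 < 1 + n%:R :> R by rewrite ltr_pwDl.
  move: (1 + n%:R : R) => m m0.
  have v0 : 0 < (2 * m)^-1 by rewrite invr_gt0 mulr_gt0.
  have l1 : ln (1 + (2 * m)^-1) <= (2 * m)^-1 by rewrite le_ln1Dx// (lt_trans (ltrN10 _)).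
  have l2 : (2 * m + 1)^-1 <= ln (1 + (2 * m)^-1).
    rewrite -[X in ln X]invrK lnV ?posrE ?invr_gt0 ?addr_gt0// -[leLHS]opprK lerN2.
    apply: le_trans (ler_ln_subr1 _) _; first by rewrite invr_gt0 addr_gt0.
    by rewrite le_eqVlt; apply/orP; left; apply/eqP; field; rewrite !gt_eqF//; lra.
  have h1 := ler_wpM2l (ltW m0) l1; have h2 := ler_wpM2l (ltW m0) l2.
  have h3 : m * (2 * m)^-1 = 2^-1 by field; rewrite gt_eqF.
  have h4 : 2^-1 - m * (2 * m + 1)^-1 <= 1 / m.
    have -> : 2^-1 - m * (2 * m + 1)^-1 = (2 * (2 * m + 1))^-1 by field; rewrite gt_eqF//; lra.
    by rewrite div1r lef_pV2 ?posrE//; lra.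
  rewrite sub0r normrN ger0_norm.
    by apply: le_trans h4; rewrite lerD2l lerN2.
  by rewrite subr_ge0 -h3.
by rewrite -(cvg_lim _ cD)// (cvg_lim _ c0).
Unshelve. all: end_near.
Qed.

(** After dropping one term, the sequence from [x] is the sequence from [1] shifted by [s = x]. *)
Lemma cvg_stirling_err (R : realType) (x : R) : 0 < x ->
  stirling_err (x + n%:R) @[n --> \oo] --> 0.
Proof.
move=> x0.
suff cS : stirling_err (1 + n%:R + x) @[n --> \oo] --> 0.
  have E : (fun n => stirling_err (x + n.+1%:R)) = (fun n => stirling_err (1 + n%:R + x)).
    by apply/funext => n; congr stirling_err; rewrite -(natr1 n); ring.
  by rewrite -cvg_shiftS E.
apply: (@cvgn_le_inv_addn R 1 (x + x ^+ 2) _ _ 0 ltr01 _ _ (@cvg_stirling_err1 R)) => [|n].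
  by rewrite addr_ge0 ?sqr_ge0 ?ltW.
by rewrite distrC stirling_err_shift// ?ltr_pwDl// ltW.
Qed.

(** * Signs of the gaps and conclusion *)

Lemma lower_gap_gt0 (R : realType) (x : R) : 0 < x -> 0 < lower_gap x.
Proof.
move=> x0; have x1 := addr_gt0 x0 ltr01.
(* The limit only gives a weak inequality, so it is used at [x + 1]; the step from [x] to [x + 1]
   supplies strictness. *)
apply: le_lt_trans (lower_gapS x0).
have c : lower_gap (x + 1 + n%:R) @[n --> \oo] --> 0.
  apply: (@cvgn_le_inv_addn R (x + 1) 1 _ _ 0 x1 ler01 _ (cvg_stirling_err x1)) => n.
  by rewrite distrC div1r lower_gap_stirling// ltr_pwDl.
have := nonincreasing_cvgn_ge (nonincreasing_lower_gap x1) (cvgP _ c) 0%N.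
by rewrite (cvg_lim _ c)// addr0.
Qed.

Lemma upper_gap_lt0 (R : realType) (x : R) : 0 < x -> upper_gap x < 0.
Proof.
move=> x0; have x1 := addr_gt0 x0 ltr01.
apply: lt_le_trans (upper_gapS x0) _.
have c : upper_gap (x + 1 + n%:R) @[n --> \oo] --> 0.
  apply: (@cvgn_le_inv_addn R (x + 1) 1 _ _ 0 x1 ler01 _ (cvg_stirling_err x1)) => n.
  by rewrite distrC div1r upper_gap_stirling// ltr_pwDl.
have := nondecreasing_cvgn_le (nondecreasing_upper_gap x1) (cvgP _ c) 0%N.
by rewrite (cvg_lim _ c)// addr0.
Qed.

Unset Implicit Arguments.

Theorem theorem2p3 (R : realType) (x : R) (hx : 0 < x) :
  expR (- (1 / 2) * digamma (x + 1 / 3))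
    < Gamma x / (Num.sqrt (2 * pi) * x `^ x * expR (- x))
  /\
  Gamma x / (Num.sqrt (2 * pi) * x `^ x * expR (- x))
    < expR (- (1 / 2) * digamma (x + 1 / 3 - 1 / (18 * x + 3))).
Proof.
rewrite -expR_lnRatio// !ltr_expR -/(shifted_arg x).
have := lower_gap_gt0 hx; have := upper_gap_lt0 hx; rewrite /lower_gap /upper_gap.
move: (lnRatio x) (digamma (shifted_arg x)) (digamma (x + 1 / 3)) => r u v; clear.
by move=> ? ?; split; lra.
Qed.
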